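(* Let $M$ be an automaton monoid, let $I$ and $\Lambda$ be finite index sets, let $P\in\mathrm{Mat}_{\Lambda\times I}(M)$ be a matrix containing the identity element $1_M$ of $M$ in some position, and let $S=\mathcal{M}[M;I,\Lambda;P]$ be the Rees matrix semigroup over $M$ with sandwich matrix $P$. If there exists an automaton for $M$ with state set $Q$ such that $1_M\in Q$ and $Q$ is closed under left-multiplication by each non-zero entry of the matrix $P$, then $S$ is an automaton semigroup.
   Context: An automaton is a triple $\mathcal{A}=(Q,B,\delta)$ where $Q$ is a finite set of states, $B$ is a finite alphabet of symbols, and $\delta$ is a transformation of $Q\times B$ (a map $Q\times B\to Q\times B$). Each state $q\in Q$ acts on the right on the set $B^*$ of finite words over $B$: for $\alpha=\alpha_1\alpha_2\cdots\alpha_n\in B^*$, $\alpha\cdot q=\beta_1\beta_2\cdots\beta_n$ where $q_0=q$ and $(q_{i-1},\alpha_i)\delta=(q_i,\beta_i)$ for $i=1,\dots,n$. A non-empty word $w=w_1\cdots w_m\in Q^+$ acts by $\alpha\cdot w=(\cdots((\alpha\cdot w_1)\cdot w_2)\cdots)\cdot w_m$. Regarding $B^*$ as a rooted tree (the children of $\alpha$ are the words $\alpha b$, $b\in B$), this gives a homomorphism $\phi:Q^+\to\operatorname{End}B^*$ to the endomorphism semigroup of the tree (maps written on the right); its image is denoted $\Sigma(\mathcal{A})$. A semigroup $S$ is an automaton semigroup if there is an automaton $\mathcal{A}$ with $S\simeq\Sigma(\mathcal{A})$; such an $\mathcal{A}$ is called an automaton for $S$. An automaton monoid is an automaton semigroup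 that is a monoid. For an automaton for $M$ with state set $Q$, states are identified with the elements of $M$ they represent: $1_M\in Q$ means that some state represents $1_M$, and $Q$ is closed under left-multiplication by $p\in M$ if for every state $x\in Q$ the element $px$ of $M$ is represented by some state in $Q$. ''Non-zero'' means different from the zero element of $M$, if $M$ has one. For a monoid $M$, index sets $I,\Lambda$, and a $\Lambda\times I$ matrix $P=(p_{\lambda i})$ with entries in $M$, the Rees matrix semigroup $\mathcal{M}[M;I,\Lambda;P]$ is the set $I\times M\times\Lambda$ with multiplication $(i,x,\lambda)(j,y,\mu)=(i,xp_{\lambda j}y,\mu)$. *)

(* Defs.v *)
(* MathComp, with classical reasoning from MathComp-Analysis' boolp. *)
From HB Require Import structures.
From mathcomp Require Import all_boot.
From mathcomp Require Import boolp.

Set Implicit Arguments.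
Unset Strict Implicit.
Unset Printing Implicit Defensive.

Local Open Scope group_scope.

Record automaton := Automaton {
  state : finType;
  symbol : finType;
  delta : state * symbol -> state * symbol
}.

(* Endomorphisms of the rooted tree B^*, in which the children of [a] are the
   words [rcons a b]: the root is fixed and each child of a vertex is sent to a
   child of the image of that vertex. *)
Definition is_tree_end (B : Type) (f : seq B -> seq B) : Prop :=
  f [::] = [::] /\ forall a b, exists c, f (rcons a b) = rcons (f a) c.

Definition tree_end (B : finType) := {f : seq B -> seq B | `[< is_tree_end f >]}.

HB.instance Definition _ (B : finType) := SubChoice.on (tree_end B).

(* Maps are written on the right: the product [f * g] applies [f] first. *)
Lemma tree_end_comp (B : finType) (f g : tree_end B) :
  `[< is_tree_end (val g \o val f) >].
Proof.
have /asboolP[f0 fS] := valP f; have /asboolP[g0 gS] := valP g.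
apply/asboolP; split=> [|a b] /=; first by rewrite f0.
by have [c ->] := fS a b; apply: gS.
Qed.

Definition tree_end_mul (B : finType) (f g : tree_end B) : tree_end B :=
  exist _ (val g \o val f) (tree_end_comp f g).

Lemma tree_end_mulA (B : finType) : associative (@tree_end_mul B).
Proof. by move=> f g h; apply: val_inj. Qed.

HB.instance Definition _ (B : finType) :=
  isSemigroup.Build (tree_end B) (@tree_end_mulA B).

Section AutomatonSemigroup.

Variable A : automaton.
Local Notation Q := (state A).
Local Notation B := (symbol A).

Fixpoint act (q : Q) (a : seq B) : seq B :=
  if a is b :: a' then (delta (q, b)).2 :: act (delta (q, b)).1 a' else [::].

Lemma act_tree_end q : `[< is_tree_end (act q) >].
Proof.
apply/asboolP; split=> // a b.
elim: a q => [|x a IH] q /=; first by exists (delta (q, b)).2.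
by have [c ->] := IH (delta (q, x)).1; exists c.
Qed.

Definition act_end (q : Q) : tree_end B := exist _ (act q) (act_tree_end q).

(* The image in End B^* of the non-empty word [q :: w]. *)
Definition word_end (q : Q) (w : seq Q) : tree_end B :=
  foldl (fun f r => f * act_end r) (act_end q) w.

Lemma word_endE q w a :
  val (word_end q w) a = foldl (fun u r => act r u) a (q :: w).
Proof.
by elim/last_ind: w => [//|w r]; rewrite /word_end /= !foldl_rcons /= => <-.
Qed.

Definition Sigma := {f : tree_end B | `[< exists q w, f = word_end q w >]}.

HB.instance Definition _ := SubChoice.on Sigma.

Lemma word_end_cat q w r v :
  word_end q w * word_end r v = word_end q (w ++ r :: v).
Proof.
rewrite /word_end foldl_cat /=; elim/last_ind: v => [//|v s IH].
by rewrite !foldl_rcons mulgA IH.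
Qed.

Lemma Sigma_mul_subproof (f g : Sigma) :
  `[< exists q w, val f * val g = word_end q w >].
Proof.
have /asboolP[q [w ->]] := valP f; have /asboolP[r [v ->]] := valP g.
by apply/asboolP; exists q, (w ++ r :: v); rewrite -word_end_cat.
Qed.

Definition Sigma_mul (f g : Sigma) : Sigma :=
  exist _ (val f * val g) (Sigma_mul_subproof f g).

Lemma Sigma_mulA : associative Sigma_mul.
Proof. by move=> f g h; apply: val_inj; rewrite /= mulgA. Qed.

HB.instance Definition _ := isSemigroup.Build Sigma Sigma_mulA.

Lemma Sigma_state_subproof q : `[< exists r w, act_end q = word_end r w >].
Proof. by apply/asboolP; exists q, [::]. Qed.

Definition Sigma_state (q : Q) : Sigma :=
  exist _ (act_end q) (Sigma_state_subproof q).

End AutomatonSemigroup.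

Definition automaton_semigroup (S : semigroupType) : Prop :=
  exists (A : automaton) (theta : {multiplicative Sigma A -> S}),
    bijective theta.

Definition is_zero (S : magmaType) (z : S) : Prop :=
  forall x : S, z * x = z /\ x * z = z.

(* [m] is the element represented by some state of [A], elements of [Sigma A]
   being identified with elements of [M] along [theta]. *)
Definition is_state (M : monoidType) (A : automaton)
    (theta : {multiplicative Sigma A -> M}) (m : M) : Prop :=
  exists q : state A, theta (Sigma_state q) = m.

Definition state_closed_lmul (M : monoidType) (A : automaton)
    (theta : {multiplicative Sigma A -> M}) (p : M) : Prop :=
  forall x : M, is_state theta x -> is_state theta (p * x).

(* The argument [P] only serves to select the multiplication. *)
Definition Rees (M : monoidType) (I Lam : Type) (P : Lam -> I -> M) : Type :=
  (I * M * Lam)%type.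

Section ReesSemigroup.

Variables (M : monoidType) (I Lam : finType) (P : Lam -> I -> M).

HB.instance Definition _ := Choice.copy (Rees P) (I * M * Lam)%type.

Definition Rees_mul (s t : Rees P) : Rees P :=
  let: (i, x, l) := s in let: (j, y, m) := t in (i, x * P l j * y, m).

Lemma Rees_mulA : associative Rees_mul.
Proof. by move=> [[i x] l] [[j y] m] [[k z] n]; rewrite /Rees_mul !mulgA. Qed.

HB.instance Definition _ := isSemigroup.Build (Rees P) Rees_mulA.

End ReesSemigroup.

(* Main.v *)
Require Import Defs.
From HB Require Import structures.
From mathcomp Require Import all_boot.
From mathcomp Require Import boolp.

(** Call a semigroup [S] self-similar over an alphabet [B] when every [s : S]
carries an output letter and a section in [S] at each letter of [B], in such a
way that the output and section of a product are computed by composing. Then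
[S] acts on words. Automaton semigroups are the self-similar semigroups whose
action on words is faithful and which have a finite generating set closed under
sections: such a set is the state set of an automaton
([automaton_semigroup_of_sections]), and conversely the sections of a product
of states are products of states ([section_stepM]).

Fix [P l0 i0 = 1]. For [S] the Rees matrix semigroup over a self-similar monoid
[M], the map x |-> (i0, x, l0) is multiplicative from [M] to [S], so it is
possible to let all the sections of elements of [S] be of this form. On the
letter [(l, b)] the element [(j, y, m)] acts as [P l j * y] does on [b] and it
replaces [l] by [m]: this is the action of [S] on the right factors of its
elements, and it is compatible with products because the [m] left behind
determines the sandwich entry of the next factor. This action may lose [j] and
[y]. A further letter, written [None], repairs this: it is turned into
[Some (j, m)], which records both indices, and the section there is
[(i0, y, l0)], which acts as [y] itself on words of letters [(l0, b)]. Hence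
the action is faithful.

The sections of the triples [(j, y, m)], with [y] in a finite set [G], have
their middle component in [G] as soon as [G] is closed under sections and under
left multiplication by all the entries of [P]. The states of the given automaton
have the second property only for nonzero entries, and closure under a zero
entry [z] amounts to [z \in G]. Since [z] is a product of states, it is enough
to replace the states by all products of a fixed number of them
([exists_adapted_mem]). *)

Set Implicit Arguments.
Unset Strict Implicit.
Unset Printing Implicit Defensive.

Local Open Scope group_scope.

(** * Self-similar semigroups *)

Section SelfSimilar.

Variables (S : semigroupType) (B : Type) (step : S -> B -> B * S).

(** [step s b] is the pair of the image of the letter [b] under [s] and the
section of [s] at [b]; [run] is the resulting action on words. *)
Fixpoint run (s : S) (a : seq B) : seq B :=
  if a is b :: a' then (step s b).1 :: run (step s b).2 a' else [::].

Definition step_morphic :=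
  forall s t b, step (s * t) b =
    ((step t (step s b).1).1, (step s b).2 * (step t (step s b).1).2).

Definition run_faithful := forall s t, run s =1 run t -> s = t.

Definition section_closed (G : seq S) :=
  forall s b, s \in G -> (step s b).2 \in G.

Lemma runM : step_morphic -> forall s t a, run (s * t) a = run t (run s a).
Proof. by move=> stepM s t a; elim: a s t => //= b a IH s t; rewrite stepM IH. Qed.

(** Sections of products are products of sections, so that pairwise products of
two section-closed sets form a section-closed set. *)
Lemma section_closed_allpairs G H : step_morphic ->
  section_closed G -> section_closed H ->
  section_closed [seq s * t | s <- G, t <- H].
Proof.
move=> stepM cG cH _ b /allpairsP[[s t] /= [Gs Ht ->]].
by rewrite stepM /=; apply: allpairs_f; [apply: cG | apply: cH].
Qed.

End SelfSimilar.

(** Generation as an induction principle: every element of [S] is a nonempty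
product of elements of [G], built by multiplying on the right. *)
Definition generates (S : semigroupType) (G : seq S) :=
  forall X : S -> Prop, (forall s, s \in G -> X s) ->
    (forall s t, X s -> t \in G -> X (s * t)) -> forall s, X s.

Lemma generatesS (S : semigroupType) (G H : seq S) :
  {subset G <= H} -> generates G -> generates H.
Proof.
move=> GH genG X XH XM; apply: genG => [s /GH | s t Xs /GH]; first exact: XH.
exact: XM.
Qed.

Section AutomatonOfSections.

Variables (S : semigroupType) (B : finType) (step : S -> B -> B * S).
Variable G : seq S.
Hypotheses (stepM : step_morphic step) (run_inj : run_faithful step).
Hypotheses (closedG : section_closed step G) (genG : generates G).

Definition section_delta (xb : seq_sub G * B) : seq_sub G * B :=
  (SeqSub (closedG xb.2 (ssvalP xb.1)), (step (ssval xb.1) xb.2).1).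

Definition section_automaton := Automaton section_delta.

Lemma act_section (x : state section_automaton) : act x =1 run step (ssval x).
Proof. by move=> a; elim: a x => //= b a IH x; rewrite IH. Qed.

Lemma Sigma_run (f : Sigma section_automaton) :
  exists s, val (val f) =1 run step s.
Proof.
have /asboolP[x [w ->]] := valP f.
elim/last_ind: w => [|w y [s IH]]; first by exists (ssval x) => a; apply: act_section.
exists (s * ssval y) => a; rewrite runM // -IH -act_section.
by rewrite /word_end foldl_rcons.
Qed.

Lemma run_Sigma s : exists f : Sigma section_automaton, val (val f) =1 run step s.
Proof.
apply: (genG (X := fun s => exists f : Sigma section_automaton, _ =1 run step s)).
  move=> {}s Gs; exists (Sigma_state (A := section_automaton) (SeqSub Gs)).
  exact: act_section.
move=> {}s t [f fs] Gt.
exists (f * Sigma_state (A := section_automaton) (SeqSub Gt)) => a.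
by rewrite runM // -fs; apply: act_section.
Qed.

(** As words act through [run], which is faithful, the action of a word of
states determines the product of these states in [S]. *)
Theorem automaton_semigroup_of_sections : automaton_semigroup S.
Proof.
pose theta f := sval (cid (Sigma_run f)).
have thetaE f : val (val f) =1 run step (theta f) by rewrite /theta; case: cid.
have theta_uniq f s : val (val f) =1 run step s -> theta f = s.
  by move=> fs; apply: run_inj => a; rewrite -thetaE fs.
have thetaM : {morph theta : f g / f * g}.
  by move=> f g; apply: theta_uniq => a; rewrite runM // -!thetaE.
pose thetaH : {multiplicative Sigma section_automaton -> S} :=
  HB.pack theta (isMultiplicative.Build _ _ theta thetaM).
exists section_automaton, thetaH.
exists (fun s => sval (cid (run_Sigma s))) => [f | s] /=.
  case: cid => g /= gf; do 2!apply: val_inj; apply/funext => a.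
  exact: etrans (gf a) (esym (thetaE f a)).
by case: cid => f /= /theta_uniq.
Qed.

End AutomatonOfSections.

(** * The self-similar structure carried by an automaton semigroup *)

Section SectionsOfAutomaton.

Variable A : automaton.
Local Notation Q := (state A).
Local Notation B := (symbol A).

(** The first letter sends each state of a word to another state, whatever
letters follow, so the section of a word of states is a word of the same
length. *)
Lemma word_end_cons (q : Q) w b : exists c r v, forall a,
  val (word_end q w) (b :: a) = c :: val (word_end r v) a.
Proof.
elim/last_ind: w => [|w s [c [r [v IH]]]].
  by exists (delta (q, b)).2, (delta (q, b)).1, [::].
exists (delta (s, c)).2, r, (rcons v (delta (s, c)).1) => a.
by rewrite /word_end !foldl_rcons /= IH.
Qed.

Lemma Sigma_cons (f : Sigma A) b :
  exists cg : B * Sigma A, forall a, val (val f) (b :: a) = cg.1 :: val (val cg.2) a.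
Proof.
have /asboolP[q [w ->]] := valP f.
have [c [r [v E]]] := word_end_cons q w b.
have rv : `[< exists r' v', word_end r v = word_end r' v' >].
  by apply/asboolP; exists r, v.
by exists (c, exist _ (word_end r v) rv).
Qed.

Definition Sigma_step f b : B * Sigma A := sval (cid (Sigma_cons f b)).

Lemma Sigma_stepE f b a :
  val (val f) (b :: a) = (Sigma_step f b).1 :: val (val (Sigma_step f b).2) a.
Proof. by rewrite /Sigma_step; case: cid => cg /= ->. Qed.

Lemma Sigma_step_uniq f b c g :
  (forall a, val (val f) (b :: a) = c :: val (val g) a) -> Sigma_step f b = (c, g).
Proof.
move=> E; have {}E a := etrans (esym (Sigma_stepE f b a)) (E a).
rewrite [LHS]surjective_pairing; congr pair; first by case: (E [::]).
by do 2!apply: val_inj; apply/funext => a; case: (E a).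
Qed.

Lemma Sigma_stepM : step_morphic Sigma_step.
Proof. by move=> f g b; apply: Sigma_step_uniq => a /=; rewrite !Sigma_stepE. Qed.

Lemma run_Sigma_step f : run Sigma_step f =1 val (val f).
Proof.
move=> a; elim: a f => [|b a IH] f /=; last by rewrite IH Sigma_stepE.
by have /asboolP[->] := valP (val f).
Qed.

Variables (M : semigroupType) (theta : {multiplicative Sigma A -> M}).
Variable rho : M -> Sigma A.
Hypotheses (thetaK : cancel theta rho) (rhoK : cancel rho theta).

Definition section_step m b : B * M :=
  ((Sigma_step (rho m) b).1, theta (Sigma_step (rho m) b).2).

Definition states : seq M := [seq theta (Sigma_state q) | q <- enum Q].

Lemma statesP m :
  reflect (exists q, theta (Sigma_state q) = m) (m \in states).
Proof.
apply: (iffP mapP) => [[q _ ->] | [q <-]]; first by exists q.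
by exists q; rewrite ?mem_enum.
Qed.

Lemma section_stepM : step_morphic section_step.
Proof.
have rhoM m n : rho (m * n) = rho m * rho n.
  by rewrite -{1}(rhoK m) -{1}(rhoK n) -gmulfM thetaK.
by move=> m n b; rewrite /section_step rhoM Sigma_stepM /= gmulfM.
Qed.

Lemma section_step_faithful : run_faithful section_step.
Proof.
have runE m : run section_step m =1 val (val (rho m)).
  move=> a; rewrite -run_Sigma_step; elim: a m => //= b a IH m.
  by rewrite IH thetaK.
move=> m n mn; apply: (can_inj rhoK); do 2!apply: val_inj.
by apply/funext => a; rewrite -!runE.
Qed.

Lemma states_closed : section_closed section_step states.
Proof.
move=> _ b /statesP[q <-]; apply/statesP; exists (delta (q, b)).1.
rewrite /section_step thetaK /=.
by rewrite (@Sigma_step_uniq _ _ (delta (q, b)).2 (Sigma_state (delta (q, b)).1)).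
Qed.

Lemma states_generate : generates states.
Proof.
move=> X XG XM m; rewrite -(rhoK m); move: (rho m) => f.
have /asboolP[q [w]] := valP f.
elim/last_ind: w f => [|w r IH] f Ef.
  have -> : f = Sigma_state q by apply: val_inj.
  by apply: XG; apply/statesP; exists q.
have qw : `[< exists q' w', word_end q w = word_end q' w' >].
  by apply/asboolP; exists q, w.
have -> : f = (exist _ (word_end q w) qw : Sigma A) * Sigma_state r.
  by apply: val_inj; rewrite Ef /word_end foldl_rcons.
by rewrite gmulfM; apply: XM; [apply: IH | apply/statesP; exists r].
Qed.

End SectionsOfAutomaton.

(** * Adjoining an element to the states *)

Section Adapted.

Variables (M : monoidType) (B : Type) (step : M -> B -> B * M).
Hypothesis stepM : step_morphic step.
(* [K] holds of the multipliers under which the set of states is stable. *)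
Variable K : M -> Prop.

Definition adapted (G : seq M) :=
  [/\ 1 \in G, section_closed step G, generates G &
      forall p x, K p -> x \in G -> p * x \in G].

(** All the properties in [adapted] pass from [H] to the set of products [H G],
which contains [H] because [G] contains [1]. *)
Lemma exists_adapted_mem G m : adapted G -> exists2 H, adapted H & m \in H.
Proof.
move=> aG; have [G1 closedG genG _] := aG.
apply: (genG (fun m => exists2 H, adapted H & m \in H)) => [{}m Gm | {}m t].
  by exists G.
case=> H [H1 closedH genH mulH] Hm Gt.
pose HG := [seq x * y | x <- H, y <- G].
have sHG : {subset H <= HG}.
  by move=> x Hx; rewrite -[x]mulg1; apply: allpairs_f.
exists HG; last exact: allpairs_f.
split; [exact: sHG | exact: section_closed_allpairs | exact: generatesS genH |].
move=> p _ Kp /allpairsP[[x y] /= [Hx Gy ->]].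
by rewrite mulgA; apply: allpairs_f => //; apply: mulH.
Qed.

End Adapted.

(** * Rees matrix semigroups over self-similar monoids *)

Section ReesSections.

Variables (M : monoidType) (I Lam B : finType) (P : Lam -> I -> M).
Variables (step : M -> B -> B * M) (G : seq M) (l0 : Lam) (i0 : I).
Hypotheses (stepM : step_morphic step) (run_inj : run_faithful step).
Hypotheses (closedG : section_closed step G) (genG : generates G).
Hypothesis mulG : forall l i x, x \in G -> P l i * x \in G.
Hypothesis P1 : P l0 i0 = 1.

Definition rees_letter : finType := (Lam * B + option (I * Lam))%type.

(** All sections have outer indices [i0] and [l0], so multiplying them involves
only the sandwich entry [P l0 i0 = 1]. *)
Definition rees_step (s : Rees P) (c : rees_letter) : rees_letter * Rees P :=
  let: (j, y, m) := s in
  match c with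
  | inl (l, b) =>
      (inl (m, (step (P l j * y) b).1), (i0, (step (P l j * y) b).2, l0))
  | inr None => (inr (Some (j, m)), (i0, y, l0))
  | inr (Some (i, l)) => (inr (Some (i, m)), (i0, P l j * y, l0))
  end.

Definition rees_gen : seq (Rees P) :=
  [seq (ix.1, ix.2, l) | ix <- [seq (i, x) | i <- enum I, x <- G], l <- enum Lam].

Lemma mem_rees_gen i x l : ((i, x, l) : Rees P) \in rees_gen = (x \in G).
Proof.
apply/allpairsP/idP => [[[[j y] m] /= [/allpairsP[[k z] /= [_ Gz [_ ->]]] _ [_ -> _]]] //|Gx].
exists ((i, x), l); split; rewrite ?mem_enum //.
by apply: allpairs_f; rewrite ?mem_enum.
Qed.

Lemma rees_mulE i x l j y m :
  ((i, x, l) : Rees P) * (j, y, m) = (i, x * P l j * y, m).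
Proof. by []. Qed.

Lemma rees_stepM : step_morphic rees_step.
Proof.
have mul0 x y : ((i0, x, l0) : Rees P) * (i0, y, l0) = (i0, x * y, l0).
  by rewrite rees_mulE P1 mulg1.
move=> [[j y] m] [[k z] n] [[l b]|[[i l]|]]; rewrite /= mul0 ?mulgA //.
by rewrite -[_ * P m k * z]mulgA stepM.
Qed.

(** Words of letters [(l0, b)] carry a copy of the action of [M], since the
sandwich entry met at every letter is [P l0 i0 = 1]. *)
Lemma run_rees_l0 x a :
  run rees_step (i0, x, l0) [seq inl (l0, b) | b <- a] =
  [seq inl (l0, b) | b <- run step x a].
Proof. by elim: a x => //= b a IH x; rewrite IH P1 mul1g. Qed.

Lemma rees_step_faithful : run_faithful rees_step.
Proof.
move=> [[i x] l] [[j y] m] E.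
have [-> ->] : i = j /\ l = m by case: (E [:: inr None]).
congr (_, _, _); apply: run_inj => a.
(* After [None] the action is that of [x] and [y] themselves. *)
have [_ _] := E (inr None :: [seq inl (l0, b) | b <- a]).
by rewrite !run_rees_l0 => /inj_map; apply=> b c [].
Qed.

Lemma rees_gen_closed : section_closed rees_step rees_gen.
Proof.
move=> [[j y] m] c; rewrite mem_rees_gen => Gy.
by case: c => [[l b]|[[i l]|]] /=; rewrite mem_rees_gen ?closedG ?mulG.
Qed.

Lemma rees_gen_generates : generates rees_gen.
Proof.
move=> X XG XM [[i x] l]; move: x l.
apply: (genG (X := fun x => forall l, X (i, x, l))) => [x Gx l | x y Xx Gy l].
  by apply: XG; rewrite mem_rees_gen.
have -> : (i, x * y, l) = ((i, x, l0) : Rees P) * (i0, y, l).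
  by rewrite rees_mulE P1 mulg1.
by apply: XM => //; rewrite mem_rees_gen.
Qed.

Lemma automaton_semigroup_Rees : automaton_semigroup (Rees P).
Proof.
exact: automaton_semigroup_of_sections rees_stepM rees_step_faithful
         rees_gen_closed rees_gen_generates.
Qed.

End ReesSections.

Theorem proposition6 (M : monoidType) (I Lam : finType) (P : Lam -> I -> M)
  (hM : automaton_semigroup M)
  (hP : exists l i, P l i = 1%g)
  (hQ : exists (A : automaton) (theta : {multiplicative Sigma A -> M}),
      bijective theta /\ is_state theta 1%g /\
      forall l i, ~ is_zero (P l i) -> state_closed_lmul theta (P l i)) :
  automaton_semigroup (Rees P).
Proof.
have [l0 [i0 P1]] := hP.
have [A [theta [[rho thetaK rhoK] [Q1 mulQ]]]] := hQ.
pose step := section_step theta rho.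
have stepM : step_morphic step by exact: section_stepM.
pose K p := exists2 li, P li.1 li.2 = p & ~ is_zero p.
have adQ : adapted step K (states theta).
  split; [exact/statesP | exact: states_closed | exact: states_generate |].
  move=> _ x [[l i] /= <- nz] /statesP Qx; apply/statesP.
  exact: mulQ nz x Qx.
(* A zero entry need not be a state, but some set of products contains it. *)
have [G [_ closedG genG mulG] zeroG] : exists2 G, adapted step K G &
    forall p, is_zero p -> p \in G.
  have [[z zz]|nz] := pselect (exists z : M, is_zero z).
    have [G adG Gz] := exists_adapted_mem stepM z adQ.
    by exists G => // p pz; rewrite -(pz z).1 (zz p).2.
  by exists (states theta) => // p pz; case: nz; exists p.
apply: (automaton_semigroup_Rees stepM _ closedG genG _ P1).
  exact: section_step_faithful.
move=> l i x Gx; have [z|nz] := pselect (is_zero (P l i)).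
  by rewrite (z x).1 zeroG.
by apply: mulG => //; exists (l, i).
Qed.
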